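(* Let $\Bbbk$ be a field and $G=\mathrm{SL}_2(\Bbbk(\varpi)[u,u^{-1}])\rtimes\Bbbk(\varpi)^*$ (affine $\mathrm{SL}_2$). The element $$g=\begin{pmatrix}1&0\\ \varpi u^{-1}&1\end{pmatrix}\begin{pmatrix}1&\varpi^{-1}u^{-1}\\ 0&1\end{pmatrix}\in \mathrm{SL}_2(\Bbbk(\varpi)[u,u^{-1}])\times\{1\}$$ belongs to $G_{twin}$ but does not belong to $I_\infty NK$. In particular $G_{twin}\not\subset I_\infty NK$: the Birkhoff decomposition does not hold on the whole of $G_{twin}$.
   Context: $\varpi,u$ are indeterminates. The semidirect product law is $(M(\varpi,u),z)(M_1(\varpi,u),z_1)=(M(\varpi,u)M_1(\varpi,zu),zz_1)$. $\mathcal O=\Bbbk[\varpi,\varpi^{-1}]$; $\omega_\oplus,\omega_\ominus$ are the valuations on $\Bbbk(\varpi)$ trivial on $\Bbbk$ with $\omega_\oplus(\varpi)=1=\omega_\ominus(\varpi^{-1})$; $\mathcal O_\oplus=\{a:\omega_\oplus(a)\ge0\}$. $G$ is the split Kac--Moody group over $\Bbbk(\varpi)$ with cocharacter lattice $Y=\mathbb Z\aleph^\vee\oplus\mathbb Zd$, character lattice $X=\mathbb Z\aleph\oplus\mathbb Z\delta$ ($\aleph(\aleph^\vee)=2$, $\aleph(d)=0$, $\delta(\aleph^\vee)=0$, $\delta(d)=1$), simple roots $\alpha_0=\delta-\aleph$, $\alpha_1=\aleph$, simple coroots $-\aleph^\vee,\aleph^\vee$, real roots $\Phi=\{\pm\aleph+k\delta:k\in\mathbb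 Z\}$. Root groups: $x_{\aleph+k\delta}(y)=(\begin{pmatrix}1&u^ky\\ 0&1\end{pmatrix},1)$, $x_{-\aleph+k\delta}(y)=(\begin{pmatrix}1&0\\ u^ky&1\end{pmatrix},1)$. $T=\{(\mathrm{diag}(y,y^{-1}),z):y,z\in\Bbbk(\varpi)^*\}$ and $N$ is the normalizer of $T$ in $G$, i.e. the set of elements of $G$ whose matrix part is diagonal or antidiagonal with nonzero entries in $\Bbbk(\varpi)^*u^{\mathbb Z}$. $G_{twin}$ is the subgroup of $G$ generated by all $x_\alpha(\mathcal O)$, $\alpha\in\Phi$, and the elements of $G$ whose matrix part is diagonal or antidiagonal with nonzero entries in $\Bbbk^*\varpi^{\mathbb Z}u^{\mathbb Z}$ and whose second component is in $\Bbbk^*\varpi^{\mathbb Z}$. $K$ is the fixator in $G$ of the origin $0_\oplus$ of the standard apartment $\mathbb A_\oplus=Y\otimes\mathbb R$ of the masure of $G$ for $\omega_\oplus$; explicitly $K=\mathrm{SL}_2(\mathcal O_\oplus[u,u^{-1}])\rtimes\mathcal O_\oplus^*$. $I_\infty$ is the fixator in $G_{twin}$ of the local chamber $C_\infty$, germ at $0_\ominus$ of $\{v:\alpha_0(v)<0,\alpha_1(v)<0\}$ in the standard apartment $\mathbb A_\ominus=Y\otimes\mathbb R$ of the masure for $\omega_\ominus$. Explicitly $I_\infty=G_{C_\infty}\cap G_{twin}$ where $G_{C_\infty}$ is generated by $\{(\mathrm{diag}(y,y^{-1}),z):\omega_\ominus(y)=\omega_\ominus(z)=0\}$ and the $x_\alpha(y)$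 ($\alpha\in\Phi$) such that $\alpha+\omega_\ominus(y)\ge0$ on $C_\infty$, i.e. $x_{\aleph+k\delta}(y)$ with $\omega_\ominus(y)>0$ if $k\ge0$, $\omega_\ominus(y)\ge0$ if $k<0$, and $x_{-\aleph+k\delta}(y)$ with $\omega_\ominus(y)>0$ if $k>0$, $\omega_\ominus(y)\ge0$ if $k\le0$. *)

(* Defs.v *)
From HB Require Import structures.
From mathcomp Require Import all_boot all_order all_algebra.
From mathcomp Require Import boolp classical_sets reals constructive_ereal.
From mathcomp Require Import topology normedtype.

Set Implicit Arguments.
Unset Strict Implicit.
Unset Printing Implicit Defensive.

Import Order.TTheory GRing.Theory Num.Theory.
Import numFieldNormedType.Exports.

Local Open Scope classical_set_scope.
Local Open Scope ring_scope.
Local Open Scope quotient_scope.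

Local Notation "x %:F" := (FracField.tofrac x) : ring_scope.

(* F(X), with X = frX and F embedded by frC. *)
Section RationalFunctions.
Variable F : fieldType.
Local Notation FX := {fraction {poly F}}.

Definition frX : FX := 'X%:F.
Definition frC (c : F) : FX := (c%:P)%:F.

(* The Laurent polynomials in X with coefficients in S. *)
Definition laurent (S : {pred F}) : {pred FX} :=
  fun x => `[< exists n (p : {poly F}),
                 p \is a polyOver S /\ x = p%:F / frX ^+ n >].

(* f(X) |-> f(zX); only meaningful for z != 0. *)
Definition rescale (z : F) (x : FX) : FX :=
  (\n_(repr x) \Po (z *: 'X))%:F / (\d_(repr x) \Po (z *: 'X))%:F.

Lemma polyOver_predT (p : {poly F}) : p \is a polyOver predT.
Proof. by apply/allP. Qed.

Lemma repr_fracE (x : FX) : x = (\n_(repr x))%:F / (\d_(repr x))%:F.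
Proof.
have d0 : (\d_(repr x))%:F != 0 :> FX by rewrite tofrac_eq0 denom_ratioP.
apply: (mulIf d0); rewrite divfK // -{1}[x]reprK.
rewrite !piE; apply/eqmodP; rewrite /= FracField.equivfE /FracField.mulf.
by rewrite !numden_Ratio ?mulr1 ?oner_neq0 ?denom_ratioP // mulrC.
Qed.

Lemma tofrac_div_inj (a b c d : {poly F}) : b != 0 -> d != 0 ->
  a%:F / b%:F = c%:F / d%:F :> FX -> a * d = c * b.
Proof.
move=> b0 d0 /eqP; rewrite eqr_div ?tofrac_eq0 // -!tofracM tofrac_eq.
by move/eqP.
Qed.

Section NonzeroScalar.
Variable z : F.
Hypothesis z0 : z != 0.

Lemma comp_scaleX_eq0 (p : {poly F}) : (p \Po (z *: 'X) == 0) = (p == 0).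
Proof.
by rewrite -!size_poly_eq0 size_comp_poly2 // size_scale // size_polyX.
Qed.

Lemma rescale_frac (a b : {poly F}) : b != 0 ->
  rescale z (a%:F / b%:F) = (a \Po (z *: 'X))%:F / (b \Po (z *: 'X))%:F.
Proof.
move=> b0; set x := a%:F / b%:F.
have d0 := denom_ratioP (repr x).
have /(tofrac_div_inj b0 d0) e := repr_fracE x.
apply/eqP; rewrite eqr_div ?tofrac_eq0 ?comp_scaleX_eq0 //.
by rewrite -!tofracM -!rmorphM /= e.
Qed.

Lemma rescale_tofrac (a : {poly F}) :
  rescale z a%:F = (a \Po (z *: 'X))%:F.
Proof.
by rewrite -[a%:F]divr1 -tofrac1 rescale_frac ?oner_eq0 // rmorph1 tofrac1 divr1.
Qed.

Lemma rescale_zmod_morphism : zmod_morphism (rescale z).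
Proof.
move=> x y; rewrite (repr_fracE x) (repr_fracE y).
move: (denom_ratioP (repr x)) (denom_ratioP (repr y)).
move: (\n_ _) (\d_ _) (\n_ _) (\d_ _) => a b c d b0 d0.
rewrite -mulNr addf_div ?tofrac_eq0 // -tofracN -!tofracM -tofracD.
rewrite !rescale_frac ?mulf_neq0 // -mulNr addf_div ?tofrac_eq0 ?comp_scaleX_eq0 //.
by rewrite -tofracN -!tofracM -tofracD !(rmorphD, rmorphM, rmorphN).
Qed.

Lemma rescale_monoid_morphism : monoid_morphism (rescale z).
Proof.
split=> [|x y]; first by rewrite -[1]tofrac1 rescale_tofrac rmorph1.
rewrite (repr_fracE x) (repr_fracE y).
move: (denom_ratioP (repr x)) (denom_ratioP (repr y)).
move: (\n_ _) (\d_ _) (\n_ _) (\d_ _) => a b c d b0 d0.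
rewrite mulf_div -!tofracM !rescale_frac ?mulf_neq0 // mulf_div.
by rewrite -!tofracM !rmorphM.
Qed.

Definition rescale_rmorphism : {rmorphism FX -> FX} :=
  HB.pack (rescale z)
    (GRing.isZmodMorphism.Build FX FX (rescale z) rescale_zmod_morphism)
    (GRing.isMonoidMorphism.Build FX FX (rescale z) rescale_monoid_morphism).

Lemma rescale_frX : rescale z frX = frC z * frX.
Proof. by rewrite rescale_tofrac comp_polyX -mul_polyC tofracM. Qed.

Lemma laurent_rescale x : x \in laurent predT -> rescale z x \in laurent predT.
Proof.
move=> /asboolP[n [p [_ ->]]]; apply/asboolP.
exists n, ((z ^+ n)^-1 *: (p \Po (z *: 'X))); split; first exact: polyOver_predT.
rewrite /frX -tofracXn rescale_frac ?expf_neq0 ?polyX_eq0 //.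
rewrite rmorphXn /= comp_polyX exprZn; apply/eqP.
rewrite eqr_div ?tofrac_eq0 ?scaler_eq0 ?expf_eq0 ?polyX_eq0 ?(negbTE z0) ?andbF //.
by rewrite -!tofracM -scalerAl -scalerAr scalerA mulVf ?expf_neq0 // scale1r.
Qed.

End NonzeroScalar.

Lemma rescale1 x : rescale 1 x = x.
Proof. by rewrite /rescale scale1r !comp_polyXr -repr_fracE. Qed.

Lemma rescaleM (z w : F) x : z != 0 -> w != 0 ->
  rescale z (rescale w x) = rescale (z * w) x.
Proof.
move=> z0 w0; rewrite [rescale w x]/rescale rescale_frac ?comp_scaleX_eq0 ?denom_ratioP //.
rewrite /rescale -!comp_polyA !comp_polyZ !comp_polyX.
by rewrite !scalerA [w * z]mulrC.
Qed.

Lemma frX_neq0 : frX != 0. Proof. by rewrite tofrac_eq0 polyX_eq0. Qed.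

Lemma laurent_subring : subring_closed (laurent predT).
Proof.
split=> [|x y /asboolP[n [p [_ ->]]] /asboolP[m [q [_ ->]]]
        |x y /asboolP[n [p [_ ->]]] /asboolP[m [q [_ ->]]]]; apply/asboolP.
- by exists 0, 1; split; [exact: polyOver_predT | rewrite tofrac1 expr0 divr1].
- exists (n + m)%N, (p * 'X^m - q * 'X^n); split; first exact: polyOver_predT.
  rewrite -mulNr addf_div ?expf_neq0 ?frX_neq0 // exprD.
  by rewrite tofracB !tofracM !tofracXn mulNr.
- exists (n + m)%N, (p * q); split; first exact: polyOver_predT.
  by rewrite exprD tofracM mulf_div.
Qed.

HB.instance Definition _ :=
  GRing.isSubringClosed.Build FX (laurent predT) laurent_subring.

Lemma laurentC c : frC c \in laurent predT.
Proof.
by apply/asboolP; exists 0, c%:P; split; [exact: polyOver_predT | rewrite expr0 divr1].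
Qed.

Lemma laurentXz (k : int) : frX ^ k \in laurent predT.
Proof.
apply/asboolP; case: k => k.
  by exists 0, 'X^k; split; [exact: polyOver_predT | rewrite expr0 divr1 tofracXn].
by exists k.+1, 1; split; [exact: polyOver_predT | rewrite tofrac1 div1r].
Qed.

End RationalFunctions.

(* k(varpi) and k(varpi)(u); the Laurent ring k(varpi)[u, u^-1] is the
   subring laurent predT of the latter. *)
Definition Kpi (k : fieldType) : fieldType := {fraction {poly k}}.
Definition Kpiu (k : fieldType) : fieldType := {fraction {poly Kpi k}}.

Definition varpi (k : fieldType) : Kpi k := frX k.
Definition uvar (k : fieldType) : Kpiu k := frX (Kpi k).

Section Valuations.
Variable k : fieldType.

(* Order of vanishing at varpi = 0, and at varpi = infinity. *)
Definition omega_plus (a : Kpi k) : \bar int :=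
  if a == 0 then +oo%E
  else ((mup 0 \n_(repr a))%:Z - (mup 0 \d_(repr a))%:Z)%:E.

Definition omega_minus (a : Kpi k) : \bar int :=
  if a == 0 then +oo%E
  else ((size \d_(repr a))%:Z - (size \n_(repr a))%:Z)%:E.

Lemma omega_plus_frac (p q : {poly k}) : p != 0 -> q != 0 ->
  omega_plus (p%:F / q%:F) = ((mup 0 p)%:Z - (mup 0 q)%:Z)%:E.
Proof.
move=> p0 q0; have a0 : p%:F / q%:F != 0 :> Kpi k.
  by rewrite mulf_neq0 ?invr_eq0 ?tofrac_eq0.
rewrite /omega_plus (negbTE a0); move: a0; set a := _ / _ => a0.
have d0 := denom_ratioP (repr a).
have n0 : \n_(repr a) != 0.
  by apply: contraNneq a0 => n0; rewrite (repr_fracE a) n0 tofrac0 mul0r.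
have /(tofrac_div_inj q0 d0)/(congr1 (mup 0)) := repr_fracE a.
rewrite !mupM // => /(congr1 Posz); rewrite !PoszD => e; congr (_%:E).
by apply/eqP; rewrite subr_eq addrAC eq_sym subr_eq e.
Qed.

Lemma omega_minus_frac (p q : {poly k}) : p != 0 -> q != 0 ->
  omega_minus (p%:F / q%:F) = ((size q)%:Z - (size p)%:Z)%:E.
Proof.
move=> p0 q0; have a0 : p%:F / q%:F != 0 :> Kpi k.
  by rewrite mulf_neq0 ?invr_eq0 ?tofrac_eq0.
rewrite /omega_minus (negbTE a0); move: a0; set a := _ / _ => a0.
have d0 := denom_ratioP (repr a).
have n0 : \n_(repr a) != 0.
  by apply: contraNneq a0 => n0; rewrite (repr_fracE a) n0 tofrac0 mul0r.
have /(tofrac_div_inj q0 d0)/(congr1 (fun r : {poly k} => (size r).+1)) :=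
  repr_fracE a.
rewrite !size_mul // !prednK ?addn_gt0 ?size_poly_gt0 ?p0 ?n0 //.
move=> /(congr1 Posz); rewrite !PoszD => e; congr (_%:E).
by apply/eqP; rewrite subr_eq addrAC eq_sym subr_eq addrC -e addrC.
Qed.

Definition O_plus : {pred Kpi k} := [pred a | (0 <= omega_plus a)%E].

Definition O_plus_unit : {pred Kpi k} :=
  [pred a | [&& a != 0, a \in O_plus & a^-1 \in O_plus]].

(* k[varpi, varpi^-1] *)
Definition O_twin : {pred Kpi k} := laurent predT.

End Valuations.

Arguments O_plus k : clear implicits.
Arguments O_plus_unit k : clear implicits.
Arguments O_twin k : clear implicits.

Definition mx2 (A : Type) (a b c d : A) : 'M[A]_2 :=
  \matrix_(i, j) if i == 0 then (if j == 0 then a else b)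
                 else (if j == 0 then c else d).

Lemma mx2M (A : pzRingType) (a b c d a' b' c' d' : A) :
  mx2 a b c d *m mx2 a' b' c' d' =
  mx2 (a * a' + b * c') (a * b' + b * d') (c * a' + d * c') (c * b' + d * d').
Proof.
apply/matrixP => i j; rewrite !mxE !big_ord_recl big_ord0 !mxE /= addr0.
by case: (i == 0); case: (j == 0).
Qed.

Lemma det_mx2 (A : comPzRingType) (a b c d : A) :
  \det (mx2 a b c d) = a * d - b * c.
Proof.
rewrite (expand_det_row _ 0) !big_ord_recl big_ord0 addr0 /cofactor !det_mx11.
by rewrite !mxE /= addn0 addn1 expr0 expr1 mul1r mulN1r mulrN.
Qed.

Section Unipotent.
Variable A : comPzRingType.

Definition upmx (a : A) : 'M[A]_2 := mx2 1 a 0 1.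
Definition lowmx (a : A) : 'M[A]_2 := mx2 1 0 a 1.

Lemma det_upmx a : \det (upmx a) = 1.
Proof. by rewrite det_mx2 mulr1 mulr0 subr0. Qed.

Lemma det_lowmx a : \det (lowmx a) = 1.
Proof. by rewrite det_mx2 mulr1 mul0r subr0. Qed.

End Unipotent.

Lemma mxOver_mx2 (A : Type) (S : {pred A}) (a b c d : A) :
  a \in S -> b \in S -> c \in S -> d \in S -> mx2 a b c d \is a mxOver S.
Proof.
by move=> *; apply/mxOverP => i j; rewrite mxE; case: (i == 0); case: (j == 0).
Qed.

(* The group SL_2(K[u, u^-1]) ><| K^*. *)
Section AffineSL2.
Variable K : fieldType.
Local Notation KU := {fraction {poly K}}.
Local Notation L := (laurent (predT : {pred K})).

Definition is_affSL2 (g : 'M[KU]_2 * K) : bool :=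
  [&& g.1 \is a mxOver L, \det g.1 == 1 & g.2 != 0].

Record affSL2 := AffSL2 { affval : 'M[KU]_2 * K; _ : is_affSL2 affval }.

Lemma is_affSL2_upmx a : a \in L -> is_affSL2 (upmx a, 1).
Proof.
move=> La; apply/and3P; split; rewrite /= ?det_upmx ?oner_eq0 //.
by apply: mxOver_mx2; rewrite ?rpred0 ?rpred1.
Qed.

Lemma is_affSL2_lowmx a : a \in L -> is_affSL2 (lowmx a, 1).
Proof.
move=> La; apply/and3P; split; rewrite /= ?det_lowmx ?oner_eq0 //.
by apply: mxOver_mx2; rewrite ?rpred0 ?rpred1.
Qed.

Lemma is_affSL2_mul1 M M' :
  is_affSL2 (M, 1) -> is_affSL2 (M', 1) -> is_affSL2 (M *m M', 1).
Proof.
move=> /and3P[/= LM /eqP dM z0] /and3P[/= LM' /eqP dM' _].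
apply/and3P; split; rewrite //= ?det_mulmx ?dM ?dM' ?mulr1 //.
apply/mxOverP => i j; rewrite mxE; apply: rpred_sum => l _.
exact: rpredM (mxOverP LM _ _) (mxOverP LM' _ _).
Qed.

HB.instance Definition _ := [isSub for affval].
HB.instance Definition _ := [Choice of affSL2 by <:].

Definition aff_one_val : 'M[KU]_2 * K := (1%:M, 1).

Definition aff_mul_val (g h : 'M[KU]_2 * K) : 'M[KU]_2 * K :=
  (g.1 *m map_mx (rescale g.2) h.1, g.2 * h.2).

Definition aff_inv_val (g : 'M[KU]_2 * K) : 'M[KU]_2 * K :=
  (map_mx (rescale g.2^-1) (\adj g.1), g.2^-1).

Lemma mxOver_rescale z (M : 'M[KU]_2) :
  z != 0 -> M \is a mxOver L -> map_mx (rescale z) M \is a mxOver L.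
Proof.
move=> z0 /mxOverP LM; apply/mxOverP => i j; rewrite mxE.
by apply: laurent_rescale => //; exact: LM.
Qed.

Lemma det_rescale n z (M : 'M[KU]_n) :
  z != 0 -> \det (map_mx (rescale z) M) = rescale z (\det M).
Proof. by move=> z0; rewrite (det_map_mx (rescale_rmorphism z0)). Qed.

Lemma aff_one_subproof : is_affSL2 aff_one_val.
Proof.
rewrite /is_affSL2 /= det1 eqxx oner_eq0 andbT; apply/mxOverP => i j.
by rewrite mxE rpredMn ?rpred1.
Qed.

Lemma aff_mul_subproof (g h : affSL2) : is_affSL2 (aff_mul_val (val g) (val h)).
Proof.
case: g h => [[M z] /= /and3P[/= LM /eqP dM z0]].
case=> [[M' z'] /= /and3P[/= LM' /eqP dM' z'0]]; apply/and3P; split=> /=.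
- apply/mxOverP => i j; rewrite mxE rpred_sum // => l _.
  exact: rpredM (mxOverP LM _ _) (mxOverP (mxOver_rescale z0 LM') _ _).
- by rewrite det_mulmx dM mul1r det_rescale // dM' (rescale_monoid_morphism z0).
- by rewrite mulf_neq0.
Qed.

Lemma aff_inv_subproof (g : affSL2) : is_affSL2 (aff_inv_val (val g)).
Proof.
case: g => [[M z] /= /and3P[/= LM /eqP dM z0]]; apply/and3P; split=> /=.
- apply: mxOver_rescale; first by rewrite invr_eq0.
  apply/mxOverP => i j; rewrite mxE; apply: rpredM.
    by apply: rpredX; rewrite rpredN1.
  apply: rpred_sum => s _; apply: rpredM.
    by apply: rpredX; rewrite rpredN1.
  by apply: rpred_prod => l _; rewrite !mxE; exact: (mxOverP LM).
- rewrite det_rescale ?invr_eq0 //.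
  have -> : \det (\adj M) = 1.
    have := congr1 determinant (mul_mx_adj M).
    by rewrite det_mulmx dM mul1r det1.
  by rewrite (rescale_monoid_morphism (z := z^-1)) ?invr_eq0.
- by rewrite invr_eq0.
Qed.

Definition aff_one := AffSL2 aff_one_subproof.
Definition aff_mul g h := AffSL2 (aff_mul_subproof g h).
Definition aff_inv g := AffSL2 (aff_inv_subproof g).

Lemma aff_mulA : associative aff_mul.
Proof.
case=> [[M z] gP] [[M' z'] gP'] [[M'' z''] gP'']; apply: val_inj => /=.
rewrite /aff_mul_val /= mulrA.
have /and3P[/= _ _ z0] := gP; have /and3P[/= _ _ z'0] := gP'.
congr (_, _); rewrite (map_mxM (rescale_rmorphism z0)) mulmxA; congr (_ *m _).
by rewrite -map_mx_comp; apply/matrixP => i j; rewrite !mxE /= rescaleM.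
Qed.

Lemma map_rescale1 n z : z != 0 -> map_mx (rescale z) 1%:M = 1%:M :> 'M[KU]_n.
Proof. by move=> z0; rewrite (map_mx1 (rescale_rmorphism z0)). Qed.

Lemma map_rescale_id n (M : 'M[KU]_n) : map_mx (rescale 1) M = M.
Proof. by apply/matrixP => i j; rewrite mxE rescale1. Qed.

Lemma aff_mul1g : left_id aff_one aff_mul.
Proof.
case=> [[M z] gP]; apply: val_inj.
by rewrite /= /aff_mul_val /= map_rescale_id mul1mx mul1r.
Qed.

Lemma aff_mulg1 : right_id aff_one aff_mul.
Proof.
case=> [[M z] gP]; apply: val_inj; have /and3P[/= _ _ z0] := gP.
by rewrite /= /aff_mul_val /= map_rescale1 // mulmx1 mulr1.
Qed.

Lemma aff_mulVg : left_inverse aff_one aff_inv aff_mul.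
Proof.
case=> [[M z] gP]; apply: val_inj; have /and3P[/= _ /eqP dM z0] := gP.
have zV0 : z^-1 != 0 by rewrite invr_eq0.
rewrite /= /aff_mul_val /= mulVf // -(map_mxM (rescale_rmorphism zV0)).
by rewrite mul_adj_mx dM map_rescale1.
Qed.

Lemma aff_mulgV : right_inverse aff_one aff_inv aff_mul.
Proof.
case=> [[M z] gP]; apply: val_inj; have /and3P[/= _ /eqP dM z0] := gP.
have zV0 : z^-1 != 0 by rewrite invr_eq0.
rewrite /= /aff_mul_val /= mulfV // -map_mx_comp.
have -> : map_mx (rescale z \o rescale z^-1) (\adj M) = \adj M.
  by apply/matrixP => i j; rewrite mxE /= rescaleM // mulfV // rescale1.
by rewrite mul_mx_adj dM.
Qed.

HB.instance Definition _ := isGroup.Build affSL2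
  aff_mulA aff_mul1g aff_mulg1 aff_mulVg aff_mulgV.

End AffineSL2.

Definition generated (G : groupType) (S : set G) : set G :=
  smallest [set H : set G | group_closed (mem H)] S.

Definition setmul (G : groupType) (A B : set G) : set G :=
  [set (a * b)%g | a in A & b in B].

Definition normalizer (G : groupType) (T : set G) : set G :=
  [set g | [set (g * t * g^-1)%g | t in T] = T].

(* A real root is recorded by its sign and the coefficient of delta. *)
Variant real_root :=
  | PosRoot of int  (* aleph + k delta *)
  | NegRoot of int. (* - aleph + k delta *)

Definition alpha0 : real_root := NegRoot 1.
Definition alpha1 : real_root := PosRoot 0.

(* The value of a root at v = v.1 aleph^vee + v.2 d in Y (x) R; note that
   aleph takes the value 2 at aleph^vee. *)
Definition root_eval (R : realType) (alpha : real_root) (v : R * R) : R :=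
  match alpha with
  | PosRoot n => 2 * v.1 + n%:~R * v.2
  | NegRoot n => - (2 * v.1) + n%:~R * v.2
  end.

(* The germ at 0 of {v | alpha0(v) < 0 and alpha1(v) < 0}, as a filter. *)
Definition C_infty (R : realType) : set_system (R * R) :=
  within [set v | root_eval alpha0 v < 0 /\ root_eval alpha1 v < 0]
         (nbhs ((0, 0) : R * R)).

Arguments C_infty R : clear implicits.

Section Subgroups.
Variable k : fieldType.
Local Notation K := (Kpi k).
Local Notation KU := (Kpiu k).
Local Notation u := (uvar k).
Local Notation G := (affSL2 K).

Definition root_mx (alpha : real_root) (y : K) : 'M[KU]_2 :=
  match alpha with
  | PosRoot n => upmx (u ^ n * frC y)
  | NegRoot n => lowmx (u ^ n * frC y)
  end.

Lemma root_mx_subproof alpha y : is_affSL2 (root_mx alpha y, 1).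
Proof.
case: alpha => n /=; [apply: is_affSL2_upmx | apply: is_affSL2_lowmx];
  exact: rpredM (laurentXz _ _) (laurentC _).
Qed.

(* x_alpha(y) *)
Definition root_elt (alpha : real_root) (y : K) : G :=
  AffSL2 (root_mx_subproof alpha y).

Definition torus_val (y z : K) : 'M[KU]_2 * K :=
  (mx2 (frC y) 0 0 (frC y^-1), z).

Definition torus : set G :=
  [set g | exists y z : K, [/\ y != 0, z != 0 & val g = torus_val y z]].

Definition N_aff : set G := normalizer torus.

(* k^* varpi^Z and k^* varpi^Z u^Z *)
Definition pi_monomial : set K :=
  [set a | exists (c : k) (m : int), c != 0 /\ a = frC c * varpi k ^ m].

Definition piu_monomial : set KU :=
  [set f | exists (a : K) (n : int), pi_monomial a /\ f = frC a * u ^ n].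

Definition twin_monomial : set G :=
  [set g | pi_monomial (val g).2 /\
     exists a b, [/\ piu_monomial a, piu_monomial b &
       (val g).1 = mx2 a 0 0 b \/ (val g).1 = mx2 0 a b 0]].

Definition G_twin : set G :=
  generated ([set g | exists alpha y, y \in O_twin k /\ g = root_elt alpha y]
             `|` twin_monomial).

(* SL_2(O_plus[u, u^-1]) ><| O_plus^*, the fixator of the origin of the
   standard apartment for omega_plus *)
Definition K_aff : set G :=
  [set g | (val g).1 \is a mxOver (laurent (O_plus k)) /\
           (val g).2 \in O_plus_unit k].

(* alpha + omega_minus(y) >= 0 on C_infty *)
Definition nonneg_on_C_infty (R : realType) (alpha : real_root) (y : K) : Prop :=
  \forall v \near C_infty R,
    (0 <= (root_eval alpha v)%:E + er_map intr (omega_minus y))%E.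

Definition G_C_infty (R : realType) : set G :=
  generated
    ([set g | exists y z : K, [/\ omega_minus y = 0%E, omega_minus z = 0%E &
                                  val g = torus_val y z]] `|`
     [set g | exists alpha y, nonneg_on_C_infty R alpha y /\
                              g = root_elt alpha y]).

Definition I_infty (R : realType) : set G := G_C_infty R `&` G_twin.

Lemma counterexample_subproof :
  is_affSL2 (lowmx (frC (varpi k) * u^-1) *m upmx (frC (varpi k)^-1 * u^-1), 1).
Proof.
apply: is_affSL2_mul1; [apply: is_affSL2_lowmx | apply: is_affSL2_upmx];
  exact: rpredM (laurentC _) (laurentXz _ (-1)).
Qed.

Definition counterexample : G := AffSL2 counterexample_subproof.

End Subgroups.

Arguments N_aff k : clear implicits.
Arguments G_twin k : clear implicits.
Arguments K_aff k : clear implicits.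
Arguments I_infty k R : clear implicits.

(* Main.v *)
Require Import Defs.
From HB Require Import structures.
From mathcomp Require Import all_boot all_order all_algebra.
From mathcomp Require Import boolp classical_sets reals.
From mathcomp Require Import constructive_ereal topology normedtype.
From mathcomp Require Import ring lra zify.

Set Implicit Arguments.
Unset Strict Implicit.
Unset Printing Implicit Defensive.

Import Order.TTheory GRing.Theory Num.Theory.
Import numFieldNormedType.Exports.

Local Open Scope classical_set_scope.

(** Write p = varpi and v = u^-1.  The matrix M of the counterexample has rows
    (1, p^-1 v) and (p v, 1 + v^2).  Read it as a clutching function between
    the charts p = infinity and p = 0: it defines a rank two bundle of degree
    zero on the projective line with coordinate p, in a family parametrized by
    u in the multiplicative group over k.  The bundle is trivial where
    1 + v^2 is invertible and splits as O(1) + O(-1) where 1 + v^2 = 0.  Since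
    1 + v^2 is not a unit in the Laurent polynomials in u, its zero locus is
    not empty and the splitting type jumps.

    A factorization of the counterexample as i n h with i in I_infty, n in N
    and h in K would force a constant splitting type, because i is regular at
    p = infinity, h is regular at p = 0 and n is a monomial matrix in the
    middle.  Indeed, for a subring S of k(p), the pairs of a matrix in
    SL_2(S[u, u^-1]) and a unit of S form a group ([affSL2_over]).  Taking S to
    be O_twin, O_minus and O_plus bounds G_twin, the fixator of C_infty and K.
    Since O_twin and O_minus meet in k[p^-1], called O_pole here, I_infty lies
    in the group of O_pole ([I_infty_over]).  An element that normalizes the
    torus has a diagonal or antidiagonal matrix with entries in k(p)^* u^Z
    ([N_aff_monomial]).  So a factorization yields Q M = B C with Q in
    SL_2(k[p^-1][u, u^-1]), B monomial and C in SL_2(O_plus[u, u^-1]), and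
    the rows of B C are e times a row over O_plus[u, u^-1] and e^-1 times
    another one, for some nonzero e in k(p).

    If e or e^-1 is divisible by p, the corresponding row of Q vanishes
    ([clutching_row_eq0]), since a Laurent polynomial over k[p^-1] that is
    divisible by p over O_plus is zero.  Otherwise e is a unit of O_plus and
    1 + v^2 divides both entries of the first column of Q
    ([clutching_row_divisible]), hence it divides det Q = 1, which is
    impossible ([not_laurent_unit_1DVsq]). *)

(** * Laurent polynomials with coefficients in a subring *)

Section LaurentPolynomials.
Local Open Scope ring_scope.
Variable F : fieldType.
Local Notation "x %:F" := (FracField.tofrac x) : ring_scope.
Local Notation X := (frX F).

HB.instance Definition _ :=
  GRing.RMorphism.copy (@frC F) (@FracField.tofrac {poly F} \o polyC).

Lemma frC_eq0 (c : F) : (frC c == 0) = (c == 0).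
Proof. by rewrite tofrac_eq0 polyC_eq0. Qed.

Lemma laurent_sub (S S' : {pred F}) :
  {subset S <= S'} -> {subset laurent S <= laurent S'}.
Proof.
move=> sSS' x /asboolP[n [p [Sp ->]]]; apply/asboolP.
by exists n, p; split=> //; exact: polyOverS Sp.
Qed.

Lemma laurent_mulXn (S : subringClosed F) n (p : {poly F}) :
  p \is a polyOver S -> p * 'X^n \is a polyOver S.
Proof. by move=> Sp; rewrite rpredM // rpredX ?polyOverX. Qed.

(** Two Laurent polynomials can be compared coefficient by coefficient once
    they are written over the same power of the variable. *)
Lemma laurent_common (S S' : subringClosed F) x y :
  x \in laurent S -> y \in laurent S' -> exists n (p q : {poly F}),
  [/\ p \is a polyOver S, q \is a polyOver S', x = p%:F / X ^+ n
    & y = q%:F / X ^+ n].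
Proof.
move=> /asboolP[n [p [Sp ->]]] /asboolP[m [q [Sq ->]]].
have X0 j : X ^+ j != 0 by rewrite expf_neq0 ?frX_neq0.
exists (n + m)%N, (p * 'X^m), (q * 'X^n); split; try exact: laurent_mulXn.
  by rewrite tofracM tofracXn exprD -mulf_div divff ?mulr1.
by rewrite tofracM tofracXn addnC exprD -mulf_div divff ?mulr1.
Qed.

Section Subring.
Variable S : subringClosed F.

Lemma laurent_subring_closed : subring_closed (laurent S).
Proof.
split=> [|x y Sx Sy|x y /asboolP[n [p [Sp ->]]] /asboolP[m [q [Sq ->]]]].
- by apply/asboolP; exists 0, 1; rewrite rpred1 tofrac1 expr0 divr1.
- have [n [p [q [Sp Sq -> ->]]]] := laurent_common Sx Sy.
  apply/asboolP; exists n, (p - q); split; first exact: rpredB.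
  by rewrite tofracB mulrBl.
- apply/asboolP; exists (n + m)%N, (p * q); split; first exact: rpredM.
  by rewrite exprD tofracM mulf_div.
Qed.

Lemma laurent_frC c : c \in S -> frC c \in laurent S.
Proof.
by move=> Sc; apply/asboolP; exists 0, c%:P; rewrite polyOverC expr0 divr1.
Qed.

Lemma laurent_frXz (n : int) : X ^ n \in laurent S.
Proof.
apply/asboolP; case: n => n.
  exists 0, 'X^n; rewrite expr0 divr1 tofracXn.
  by split; [apply: rpredX; apply: polyOverX|].
by exists n.+1, 1; split; [apply: rpred1 | rewrite tofrac1 div1r].
Qed.

Lemma laurent_rescale_over z x : z != 0 -> z \in S -> z^-1 \in S ->
  x \in laurent S -> rescale z x \in laurent S.
Proof.
move=> z0 Sz SVz /asboolP[n [p [Sp ->]]]; apply/asboolP.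
exists n, (z^-1 ^+ n *: (p \Po (z *: 'X))); split.
  apply: polyOverZ; first exact: rpredX.
  by apply: polyOver_comp => //; apply: polyOverZ => //; apply: polyOverX.
rewrite -[LHS]/(rescale_rmorphism z0 _) fmorph_div rmorphXn /=.
rewrite rescale_tofrac // rescale_frX // exprMn invfM mulrA; congr (_ / _).
by rewrite -[in RHS]mul_polyC tofracM mulrC -/(frC _) rmorphXn fmorphV exprVn.
Qed.

End Subring.

Lemma laurent_frC_div (S : subringClosed F) a b :
  a / b \in S -> frC a / frC b \in laurent S.
Proof. by move=> Sab; rewrite -fmorphV -rmorphM; exact: laurent_frC. Qed.

Lemma laurent_frCV (S : subringClosed F) a :
  a^-1 \in S -> (frC a)^-1 \in laurent S.
Proof. by move=> SVa; rewrite -fmorphV; exact: laurent_frC. Qed.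

Lemma laurent_frCV_div (S : subringClosed F) a b :
  a^-1 / b \in S -> (frC a)^-1 / frC b \in laurent S.
Proof. by rewrite -fmorphV; exact: laurent_frC_div. Qed.

(** Indexed by the structure S and not by its carrier, so that the subring
    structure of the Laurent polynomials can be inferred for every S. *)
Definition laurent_over (S : subringClosed F) : {pred {fraction {poly F}}} :=
  laurent S.

HB.instance Definition _ (S : subringClosed F) :=
  GRing.isSubringClosed.Build {fraction {poly F}} (laurent_over S)
    (laurent_subring_closed S).

Lemma laurentI (S S' : subringClosed F) x : x \in laurent S ->
  x \in laurent S' -> x \in laurent [pred a | (a \in S) && (a \in S')].
Proof.
move=> Sx S'x; have [n [p [q [Sp Sq xp xq]]]] := laurent_common Sx S'x.
have X0 : X ^+ n != 0 by rewrite expf_neq0 ?frX_neq0.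
have epq : p = q.
  by apply/eqP; rewrite -tofrac_eq; apply/eqP/(divIf X0); rewrite -xp -xq.
apply/asboolP; exists n, p; split=> //; apply/allP => c pc.
by apply/andP; split; [exact: (allP Sp) | rewrite epq in pc; exact: (allP Sq)].
Qed.

(** If p q = X^N in F[X], then p is a scalar multiple of a power of X. *)
Lemma laurent_unit a b : a \in laurent (predT : {pred F}) ->
  b \in laurent (predT : {pred F}) -> a * b = 1 ->
  exists c (n : int), c != 0 /\ a = frC c * X ^ n.
Proof.
move=> /asboolP[n [p [_ ->]]] /asboolP[m [q [_ ->]]] /eqP.
have X0 j : X ^+ j != 0 by rewrite expf_neq0 ?frX_neq0.
rewrite mulf_div -exprD -(divr1 1) eqr_div ?oner_neq0 ?X0 // mulr1 mul1r.
rewrite /frX -tofracXn -tofracM tofrac_eq => /eqP epq.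
have : p %| ('X - 0%:P) ^+ (n + m) by rewrite subr0 -epq dvdp_mulr.
case/dvdp_exp_XsubCP => j _; rewrite subr0 => /eqpP[[c d] /= /andP[c0 d0] e].
have -> : p = (d / c) *: 'X^j by rewrite mulrC -scalerA -e scalerA mulVf ?scale1r.
exists (d / c), (j%:Z - n%:Z); split; first by rewrite mulf_neq0 ?invr_eq0.
by rewrite -mul_polyC tofracM tofracXn expfzDr ?frX_neq0 // -exprnP -exprnN mulrA.
Qed.

Lemma laurent_1DVsq_neq0 : 1 + X^-1 ^+ 2 != 0.
Proof.
have key (K : fieldType) (s : K) : s != 0 -> 1 + s != 0 -> 1 + s^-1 != 0.
  move=> s0; apply: contraNneq => e.
  by have -> : 1 + s = s * (1 + s^-1) by [field]; rewrite e mulr0.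
rewrite exprVn; apply: key; first by rewrite expf_neq0 ?frX_neq0.
rewrite /frX -tofracXn -tofrac1 -tofracD tofrac_eq0; apply/eqP.
move/(congr1 (fun r : {poly F} => r`_0)); rewrite coefD coefXn coef1 coef0 addr0.
by move/eqP; rewrite oner_eq0.
Qed.

(** Otherwise 1 + X^2 would divide a power of X in F[X], hence be a scalar
    multiple of some X^j; but its coefficients of degree 0 and 2 are both
    nonzero. *)
Lemma not_laurent_unit_1DVsq w : w \in laurent (predT : {pred F}) ->
  (1 + X^-1 ^+ 2) * w != 1.
Proof.
move=> /asboolP[n [p [_ ->]]]; apply/eqP => e.
have X0 j : X ^+ j != 0 by rewrite expf_neq0 ?frX_neq0.
have key (K : fieldType) (s t q : K) : s != 0 -> t != 0 ->
    (1 + s) * q = t * s * ((1 + s^-1) * (q / t)).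
  by move=> s0 t0; field; rewrite s0 t0.
have {e} : (1 + 'X^2) * p = 'X^(n.+2).
  apply/eqP; rewrite -tofrac_eq tofracM tofracD !tofracXn tofrac1 -/(frX F).
  by rewrite (key _ _ _ _ (X0 2%N) (X0 n)) -exprVn e mulr1 -(addn2 n) exprD.
move=> e.
have : (1 + 'X^2 : {poly F}) %| ('X - 0%:P) ^+ n.+2.
  by rewrite subr0 -e dvdp_mulr.
case/dvdp_exp_XsubCP => j _; rewrite subr0 => /eqpP[[c d] /= /andP[c0 d0] ej].
have := congr1 (fun r : {poly F} => r`_0) ej.
have := congr1 (fun r : {poly F} => r`_2) ej.
rewrite !(coefZ, coefD, coefXn, coef1) /= add0r addr0 !mulr1.
case: (eqVneq 2%N j) => [<-|_] ea eb; [move: eb|move: ea];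
  by rewrite mulr0 => /eqP; rewrite (negbTE c0).
Qed.

End LaurentPolynomials.

(** * The coefficient rings k[varpi^-1] and O_plus *)

Section CoefficientRings.
Local Open Scope ring_scope.
Variable k : fieldType.
Local Notation "x %:F" := (FracField.tofrac x) : ring_scope.
Local Notation K := (Kpi k).
Local Notation pi := (varpi k).
Implicit Types (a b : K) (p q : {poly k}).

Lemma Kpi_fracP a : a != 0 -> exists p q, [/\ p != 0, q != 0 & a = p%:F / q%:F].
Proof.
move=> a0; exists \n_(repr a), \d_(repr a).
split; [|exact: denom_ratioP|exact: repr_fracE].
by apply: contraNneq a0 => n0; rewrite (repr_fracE a) n0 tofrac0 mul0r.
Qed.

Lemma varpi_neq0 : pi != 0. Proof. exact: frX_neq0. Qed.

(** O_plus is the local ring of the line at varpi = 0: the common power of varpi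
    can be cancelled from numerator and denominator. *)
Lemma O_plusP a : a \in O_plus k <->
  exists p q, ~~ root q 0 /\ a = p%:F / q%:F.
Proof.
split=> [|[p [q [q0 ->]]]]; last first.
  have qN0 : q != 0 by apply: contraNneq q0 => ->; rewrite root0.
  have [->|p0] := eqVneq p 0.
    by rewrite tofrac0 mul0r inE /omega_plus eqxx.
  by rewrite inE omega_plus_frac // (mupNroot q0) subr0 lee_fin.
have [-> _|/Kpi_fracP[p [q [p0 q0 ->]]]] := eqVneq a 0.
  by exists 0, 1; rewrite root1 tofrac0 mul0r.
rewrite inE omega_plus_frac // lee_fin subr_ge0 lez_nat mup_geq //.
have : ('X - 0%:P) ^+ mup 0 q %| q by rewrite -mup_geq.
have : ~~ (('X - 0%:P) ^+ (mup 0 q).+1 %| q) by rewrite -mup_leq.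
move: (mup 0 q) => m qm /dvdpP[q' eq] /dvdpP[p' ep].
have Xm0 : ('X - 0%:P) ^+ m != 0 :> {poly k}.
  by rewrite expf_neq0 // subr0 polyX_eq0.
exists p', q'; split.
  apply: contra qm; rewrite root_factor_theorem => /dvdpP[r er].
  by rewrite eq er -mulrA -exprS dvdp_mull.
rewrite ep eq !tofracM -mulf_div divff ?mulr1 //.
by rewrite tofrac_eq0.
Qed.

Lemma O_plus_subring_closed : subring_closed (O_plus k).
Proof.
have tofN0 q : ~~ root q 0 -> q%:F != 0 :> K.
  by move=> q0; rewrite tofrac_eq0; apply: contraNneq q0 => ->; rewrite root0.
split=> [|a b /O_plusP[p [q [q0 ->]]] /O_plusP[p' [q' [q'0 ->]]]
         |a b /O_plusP[p [q [q0 ->]]] /O_plusP[p' [q' [q'0 ->]]]];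
  apply/O_plusP.
- by exists 1, 1; rewrite root1 tofrac1 divr1.
- exists (p * q' - p' * q), (q * q'); rewrite rootM negb_or q0 q'0; split=> //.
  by rewrite -mulNr addf_div ?tofN0 // tofracB !tofracM mulNr.
- exists (p * p'), (q * q'); rewrite rootM negb_or q0 q'0; split=> //.
  by rewrite mulf_div !tofracM.
Qed.

HB.instance Definition _ :=
  GRing.isSubringClosed.Build K (O_plus k) O_plus_subring_closed.

(** The order of vanishing of a at varpi = 0 is positive, negative or zero. *)
Lemma O_plus_trichotomy a : a != 0 ->
  [\/ a / pi \in O_plus k, a^-1 / pi \in O_plus k
    | (a \in O_plus k) && (a^-1 \in O_plus k)].
Proof.
move=> /Kpi_fracP[p [q [p0 q0 ->]]].
have mupX (r : {poly k}) : r != 0 -> mup 0 (r * 'X) = (mup 0 r).+1.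
  move=> r0; have := mup_XsubCX 1 (0 : k) 0; rewrite subr0 eqxx expr1 => eX.
  by rewrite mupM ?polyX_eq0 // eX addn1.
have eV : (p%:F / q%:F)^-1 = q%:F / p%:F :> K by rewrite invf_div.
have eX (r s : {poly k}) : r%:F / s%:F / pi = r%:F / (s * 'X)%:F.
  by rewrite tofracM invfM mulrA.
rewrite eV !eX !inE !omega_plus_frac ?mulf_neq0 ?polyX_eq0 //.
rewrite !mupX // !lee_fin !subr_ge0 !lez_nat.
case: (ltngtP (mup 0 p) (mup 0 q)) => h.
- by apply: Or32.
- by apply: Or31.
- by apply: Or33.
Qed.

Definition O_minus : {pred K} := [pred a | (0 <= omega_minus a)%E].

Lemma O_minusP a : a \in O_minus <->
  exists p q, [/\ q != 0, (size p <= size q)%N & a = p%:F / q%:F].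
Proof.
split=> [|[p [q [q0 spq ->]]]]; last first.
  have [->|p0] := eqVneq p 0.
    by rewrite tofrac0 mul0r inE /omega_minus eqxx.
  by rewrite inE omega_minus_frac // lee_fin subr_ge0 lez_nat.
have [-> _|/Kpi_fracP[p [q [p0 q0 ->]]]] := eqVneq a 0.
  by exists 0, 1; rewrite oner_neq0 size_poly0 tofrac0 mul0r.
rewrite inE omega_minus_frac // lee_fin subr_ge0 lez_nat => spq.
by exists p, q.
Qed.

Lemma O_minus_subring_closed : subring_closed O_minus.
Proof.
have sM p q p' q' : q != 0 -> q' != 0 -> (size p <= size q)%N ->
    (size p' <= size q')%N -> (size (p * p')%R <= size (q * q')%R)%N.
  move=> q0 q'0 s s'; have [->|p0] := eqVneq p 0; first by rewrite mul0r size_poly0.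
  have [->|p'0] := eqVneq p' 0; first by rewrite mulr0 size_poly0.
  by rewrite !size_mul // -!subn1 leq_sub2r ?leq_add.
split=> [|a b /O_minusP[p [q [q0 s ->]]] /O_minusP[p' [q' [q'0 s' ->]]]
         |a b /O_minusP[p [q [q0 s ->]]] /O_minusP[p' [q' [q'0 s' ->]]]];
  apply/O_minusP.
- by exists 1, 1; rewrite oner_neq0 tofrac1 divr1.
- exists (p * q' - p' * q), (q * q'); rewrite mulf_neq0 //; split=> //.
    rewrite (leq_trans (size_polyD _ _)) // size_polyN geq_max.
    by rewrite sM // [q * q']mulrC sM.
  by rewrite -mulNr addf_div ?tofrac_eq0 // tofracB !tofracM mulNr.
- exists (p * p'), (q * q'); rewrite mulf_neq0 //; split=> //; first exact: sM.
  by rewrite mulf_div !tofracM.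
Qed.

HB.instance Definition _ :=
  GRing.isSubringClosed.Build K O_minus O_minus_subring_closed.

HB.instance Definition _ :=
  GRing.isSubringClosed.Build K (O_twin k) (laurent_subring k).

(** This is k[varpi^-1], the rational functions with no pole except at
    varpi = 0 (see [O_poleP]). *)
Definition O_pole : {pred K} := [pred a | (a \in O_twin k) && (a \in O_minus)].

Lemma O_pole_subring_closed : subring_closed O_pole.
Proof.
split=> [|a b /andP[ta ma] /andP[tb mb]|a b /andP[ta ma] /andP[tb mb]].
- by apply/andP; rewrite !rpred1.
- by apply/andP; rewrite !rpredB.
- by apply/andP; rewrite !rpredM.
Qed.

HB.instance Definition _ :=
  GRing.isSubringClosed.Build K O_pole O_pole_subring_closed.

Lemma O_poleP a : a \in O_pole <->
  exists n p, (size p <= n.+1)%N /\ a = p%:F / pi ^+ n.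
Proof.
split=> [/andP[/asboolP[n [p [_ ->]]]]|[n [p [sp ->]]]].
  have [-> _|p0] := eqVneq p 0.
    by exists 0, 0; rewrite size_poly0 tofrac0 !mul0r.
  rewrite /= -tofracXn inE omega_minus_frac ?expf_neq0 ?polyX_eq0 //.
  rewrite size_polyXn lee_fin subr_ge0 lez_nat => sp.
  by exists n, p; rewrite -tofracXn.
apply/andP; split.
  by apply/asboolP; exists n, p; split=> //; exact: polyOver_predT.
apply/O_minusP; exists p, 'X^n; rewrite expf_neq0 ?polyX_eq0 // size_polyXn.
by rewrite tofracXn.
Qed.

Lemma O_twin_varpi : pi \in O_twin k.
Proof. exact: (laurentXz k 1). Qed.

Lemma O_twin_Vvarpi : pi^-1 \in O_twin k.
Proof. exact: (laurentXz k (-1)). Qed.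

Lemma O_pole_Vvarpi : pi^-1 \in O_pole.
Proof.
by apply/O_poleP; exists 1%N, 1; rewrite size_poly1 tofrac1 mul1r expr1.
Qed.

(** A function that is regular away from varpi = 0 and vanishes at varpi = 0 is a
    global function on the projective line with a zero, hence it is zero. *)
Lemma O_pole_O_plus_eq0 a : a \in O_pole -> a / pi \in O_plus k -> a = 0.
Proof.
move=> /O_poleP[n [p [sp ->]]].
have [->|p0] := eqVneq p 0; first by rewrite tofrac0 mul0r.
rewrite -mulrA -invfM -exprSr /varpi /frX -tofracXn inE.
rewrite omega_plus_frac ?expf_neq0 ?polyX_eq0 // lee_fin subr_ge0 lez_nat.
have := mup_XsubCX n.+1 (0 : k) 0; rewrite subr0 eqxx => ->.
rewrite mup_geq // subr0 => /(dvdp_leq p0); rewrite size_polyXn => h.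
by have := leq_trans h sp; rewrite ltnn.
Qed.

(** The element c is the constant term of a polynomial in varpi^-1. *)
Lemma O_pole_split a : a \in O_pole ->
  exists c b, [/\ c \in O_plus k, c \in O_pole, b \in O_pole & a = c + b / pi].
Proof.
move=> /O_poleP[n [p [sp ->]]].
have key (L : fieldType) (r s t c : L) : s != 0 -> t != 0 ->
    r / t = c + (r - c * t) * s / t / s.
  by move=> s0 t0; field; rewrite s0 t0.
have C c : frC c \in O_plus k /\ frC c \in O_pole.
  split; first by apply/O_plusP; exists c%:P, 1; rewrite root1 tofrac1 divr1.
  apply/O_poleP; exists 0, c%:P; rewrite expr0 divr1; split=> //.
  exact: size_polyC_leq1.
(* The coefficient of degree n of p is the constant term, because a = p / pi^n. *)
exists (frC p`_n), (((p - p`_n *: 'X^n) * 'X)%:F / pi ^+ n).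
have [Cp Cm] := C p`_n; split=> //.
  apply/O_poleP; exists n, ((p - p`_n *: 'X^n) * 'X); split=> //.
  apply/leq_sizeP => -[|i]; first by [].
  rewrite ltnS => ni; rewrite coefMX /= coefB coefZ coefXn.
  move: ni; rewrite leq_eqVlt => /predU1P[->|ni]; first by rewrite eqxx mulr1 subrr.
  by rewrite (gtn_eqF ni) mulr0 subr0 nth_default // (leq_trans sp).
rewrite tofracM tofracB -mul_polyC tofracM tofracXn.
by apply: key; rewrite ?expf_neq0 ?varpi_neq0.
Qed.

End CoefficientRings.

Arguments O_minus k : clear implicits.
Arguments O_pole k : clear implicits.

(** * Groups of Laurent matrices over a subring *)

Section LaurentGroups.
Local Open Scope ring_scope.
Variable F : fieldType.
Local Notation FX := {fraction {poly F}}.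
Local Notation G := (affSL2 F).
Variable S : subringClosed F.

(** This is the semidirect product of SL_2(S[X, X^-1]) and the units of S. *)
Definition affSL2_over : set G :=
  [set g | [/\ (val g).1 \is a mxOver (laurent_over S), (val g).2 \in S
             & (val g).2^-1 \in S]].

Lemma mxOver_adj2 (M : 'M[FX]_2) :
  M \is a mxOver (laurent_over S) -> \adj M \is a mxOver (laurent_over S).
Proof.
move=> /mxOverP LM; apply/mxOverP => i j; rewrite mxE rpredM //.
  by rewrite rpredX // rpredN1.
rewrite rpred_sum // => s _; rewrite rpredM //; first by rewrite rpredX // rpredN1.
by rewrite rpred_prod // => l _; rewrite !mxE.
Qed.

Lemma mxOver_rescale_over z (M : 'M[FX]_2) : z != 0 -> z \in S -> z^-1 \in S ->
  M \is a mxOver (laurent_over S) ->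
  map_mx (rescale z) M \is a mxOver (laurent_over S).
Proof.
move=> z0 Sz SVz /mxOverP LM; apply/mxOverP => i j; rewrite mxE.
exact: laurent_rescale_over (LM i j).
Qed.

(** Rescaling the variable by a unit of S preserves S[X, X^-1], and the inverse
    of a matrix of determinant 1 is its adjugate. *)
Lemma affSL2_over_group_closed : group_closed (mem affSL2_over).
Proof.
split=> [|g h /set_mem[gM gz gVz] /set_mem[hM hz hVz]]; apply/mem_set.
  by split; rewrite /= ?invr1 ?rpred1 //; exact: mxOver_scalar (rpred0 _) (rpred1 _).
have /and3P[_ _ g0] := valP g; have /and3P[_ _ h0] := valP h.
split=> /=; rewrite ?invfM ?invrK; try exact: rpredM.
apply: mxOverM => //; apply: mxOver_rescale_over => //.
by apply: mxOver_rescale_over; rewrite ?invr_eq0 ?invrK //; exact: mxOver_adj2.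
Qed.

Lemma generated_affSL2_over (A : set G) :
  A `<=` affSL2_over -> generated A `<=` affSL2_over.
Proof. exact: smallest_sub affSL2_over_group_closed. Qed.

Lemma upmx_over a : a \in laurent_over S -> upmx a \is a mxOver (laurent_over S).
Proof. by move=> La; apply: mxOver_mx2; rewrite ?rpred0 ?rpred1. Qed.

Lemma lowmx_over a : a \in laurent_over S -> lowmx a \is a mxOver (laurent_over S).
Proof. by move=> La; apply: mxOver_mx2; rewrite ?rpred0 ?rpred1. Qed.

Lemma diagmx_over a b : a \in laurent_over S -> b \in laurent_over S ->
  mx2 a 0 0 b \is a mxOver (laurent_over S).
Proof. by move=> La Lb; apply: mxOver_mx2; rewrite ?rpred0. Qed.

Lemma antidiagmx_over a b : a \in laurent_over S -> b \in laurent_over S ->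
  mx2 0 a b 0 \is a mxOver (laurent_over S).
Proof. by move=> La Lb; apply: mxOver_mx2; rewrite ?rpred0. Qed.

End LaurentGroups.

Section TwinGroups.
Local Open Scope ring_scope.
Variable k : fieldType.
Local Notation K := (Kpi k).
Local Notation pi := (varpi k).
Local Notation u := (uvar k).

Lemma root_elt_over (S : subringClosed K) alpha y :
  y \in S -> affSL2_over S (root_elt alpha y).
Proof.
move=> Sy; split; last 2 first.
- exact: rpred1.
- by rewrite invr1; exact: rpred1.
case: alpha => n; [apply: upmx_over | apply: lowmx_over]; apply: rpredM.
- exact: laurent_frXz.
- exact: laurent_frC.
- exact: laurent_frXz.
- exact: laurent_frC.
Qed.

Lemma pi_monomial_O_twin a :
  pi_monomial a -> a \in O_twin k /\ a^-1 \in O_twin k.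
Proof.
move=> [c [m [c0 ->]]]; split; first exact: rpredM (laurentC c) (laurentXz k m).
rewrite invfM -fmorphV invr_expz; exact: rpredM (laurentC _) (laurentXz k _).
Qed.

Lemma piu_monomial_O_twin f :
  piu_monomial f -> f \in laurent_over (O_twin k).
Proof.
move=> [a [n [/pi_monomial_O_twin[Oa _] ->]]].
exact: rpredM (laurent_frC Oa : _ \in laurent_over _) (laurent_frXz _ n).
Qed.

Lemma G_twin_over : G_twin k `<=` affSL2_over (O_twin k).
Proof.
apply: generated_affSL2_over => g [[alpha [y [Oy ->]]]|].
  exact: root_elt_over.
move=> [/pi_monomial_O_twin[z zV] [a [b [Ma Mb E]]]]; split=> //.
have La := piu_monomial_O_twin Ma; have Lb := piu_monomial_O_twin Mb.
by case: E => ->; [exact: diagmx_over | exact: antidiagmx_over].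
Qed.

Lemma counterexample_twin : G_twin k (counterexample k).
Proof.
have rootG alpha y : y \in O_twin k -> G_twin k (root_elt alpha y).
  by move=> Oy H [_]; apply; left; exists alpha, y.
(* The counterexample is a product of two root elements, whose parameters pi
   and pi^-1 lie in O_twin. *)
have -> : counterexample k =
    (root_elt (NegRoot (-1)) pi * root_elt (PosRoot (-1)) pi^-1)%g.
  apply: val_inj; rewrite /= /aff_mul_val /= map_rescale_id mulr1.
  rewrite -exprN1.
  have lowC (a b : Kpiu k) : lowmx (a * b) = lowmx (b * a) by rewrite mulrC.
  have upC (a b : Kpiu k) : upmx (a * b) = upmx (b * a) by rewrite mulrC.
  by apply: (f_equal2 (fun M N => (M *m N, 1))); [exact: lowC | exact: upC].
have divG g h : G_twin k g -> G_twin k h -> G_twin k (g / h)%g.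
  move=> Gg Gh H HS; have [[_ HV] _] := HS.
  by have /set_mem := HV g h (mem_set (Gg H HS)) (mem_set (Gh H HS)).
have oneG : G_twin k 1%g by move=> H [[/set_mem H1 _] _].
rewrite -[X in (_ * X)%g]invgK; apply: (divG).
  exact: rootG (O_twin_varpi k).
rewrite -[(_^-1)%g]mul1g; apply: (divG) oneG _.
exact: rootG (O_twin_Vvarpi k).
Qed.

Lemma K_aff_over : K_aff k `<=` affSL2_over (O_plus k).
Proof. by move=> g [gM /and3P[_ z zV]]. Qed.

End TwinGroups.

(** * A clutching matrix that does not split *)

Section Clutching.
Local Open Scope ring_scope.

(** Lminus and Lplus stand for the Laurent polynomials in u over k[p^-1] and over
    O_plus, inside the field k(p)(u). *)
Variables (L : fieldType) (Lminus Lplus : subringClosed L) (p v : L).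
Hypotheses (p0 : p != 0) (v1 : 1 + v ^+ 2 != 0).
Hypotheses (vminus : v \in Lminus) (vplus : v \in Lplus).
Hypothesis pVminus : p^-1 \in Lminus.
Hypothesis disjoint : forall x, x \in Lminus -> x / p \in Lplus -> x = 0.
Hypothesis split : forall x, x \in Lminus ->
  exists c b, [/\ c \in Lplus, c \in Lminus, b \in Lminus & x = c + b / p].

Definition clutching : 'M[L]_2 := lowmx (p * v) *m upmx (p^-1 * v).

Lemma mul_clutching a b c d : mx2 a b c d *m clutching =
  mx2 (a + b * (p * v)) (a * (p^-1 * v) + b * (1 + v ^+ 2))
      (c + d * (p * v)) (c * (p^-1 * v) + d * (1 + v ^+ 2)).
Proof.
have e (x y : L) : (x * 1 + y * (p * v)) * (p^-1 * v) + (x * 0 + y * 1) * 1 =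
    x * (p^-1 * v) + y * (1 + v ^+ 2) by field.
rewrite /clutching /lowmx /upmx mulmxA !mx2M !e.
by rewrite !mulr1 !mulr0 !addr0.
Qed.

(** Write f1, f2 for the entries of (a, b) M.  Inverting M gives
    a = (1 + v^2) f1 - p v f2.  As f2 lies in Lminus and in p Lplus, it is zero;
    then a = (1 + v^2) f1 lies in both as well, so a = 0, and
    f2 = (1 + v^2) b gives b = 0. *)
Lemma clutching_row_eq0 a b : a \in Lminus -> b \in Lminus ->
  (a + b * (p * v)) / p \in Lplus ->
  (a * (p^-1 * v) + b * (1 + v ^+ 2)) / p \in Lplus -> a = 0 /\ b = 0.
Proof.
move=> La Lb; set f1 := a + _; set f2 := _ + b * _ => Lf1 Lf2.
have f20 : f2 = 0 by apply: (disjoint) Lf2; rewrite rpredD ?rpredM ?rpredD ?rpredX ?rpred1.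
have ea : a / p = (1 + v ^+ 2) * (f1 / p) - v * f2 by rewrite /f1 /f2; field.
have a0 : a = 0.
  by apply: (disjoint) => //; rewrite ea f20 mulr0 subr0 rpredM ?rpredD ?rpredX ?rpred1.
split=> //; move: f20; rewrite /f2 a0 mul0r add0r => /eqP.
by rewrite mulf_eq0 (negbTE v1) orbF => /eqP.
Qed.

(** Split b as b0 + b1 / p and put w = a + v b1.  In
    a = (1 + v^2) f1 - p v f2 the entry f1 is w + p v b0, so a - (1 + v^2) w
    equals p ((1 + v^2) v b0 - v f2): it lies in Lminus and in p Lplus, hence
    it is zero. *)
Lemma clutching_row_divisible a b : a \in Lminus -> b \in Lminus ->
  a + b * (p * v) \in Lplus ->
  a * (p^-1 * v) + b * (1 + v ^+ 2) \in Lplus ->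
  exists2 w, w \in Lminus & a = (1 + v ^+ 2) * w.
Proof.
move=> La Lb; set f1 := a + _; set f2 := _ + b * _ => Lf1 Lf2.
have [b0 [b1 [b0p b0m b1m eb]]] := split Lb.
exists (a + v * b1); first by rewrite rpredD ?rpredM.
apply/eqP; rewrite -subr_eq0; apply/eqP; apply: (disjoint).
  by rewrite rpredB ?rpredM ?rpredD ?rpredM ?rpredX ?rpred1.
have -> : (a - (1 + v ^+ 2) * (a + v * b1)) / p = (1 + v ^+ 2) * v * b0 - v * f2.
  by rewrite /f2 eb; field.
have v2p : 1 + v ^+ 2 \in Lplus by rewrite rpredD ?rpred1 ?rpredX.
by apply: rpredB; rewrite !rpredM.
Qed.

(** If p divides e or e', a row of the first factor is zero, against its
    determinant being 1; otherwise 1 + v^2 divides its first column, hence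
    its determinant. *)
Lemma clutching_not_split a b c d x y z t e e' :
  [/\ a \in Lminus, b \in Lminus, c \in Lminus & d \in Lminus] ->
  a * d - b * c = 1 ->
  [/\ x \in Lplus, y \in Lplus, z \in Lplus & t \in Lplus] ->
  mx2 a b c d *m clutching = mx2 (e * x) (e * y) (e' * z) (e' * t) ->
  [\/ e / p \in Lplus, e' / p \in Lplus | (e \in Lplus) && (e' \in Lplus)] ->
  exists2 w, w \in Lminus & (1 + v ^+ 2) * w = 1.
Proof.
move=> [La Lb Lc Ld] det1 [Lx Ly Lz Lt]; rewrite mul_clutching => E.
have entry i j := congr1 (fun M : 'M_2 => M i j) E.
move: (entry 0 0) (entry 0 1) (entry 1 0) (entry 1 1).
rewrite !mxE /= => e1 e2 e3 e4 [Le|Le|/andP[Le Le']].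
- have [a0 b0] : a = 0 /\ b = 0.
    by apply: clutching_row_eq0 => //; rewrite ?e1 ?e2 mulrAC rpredM.
  by move: det1; rewrite a0 b0 !mul0r subr0 => /eqP; rewrite eq_sym oner_eq0.
- have [c0 d0] : c = 0 /\ d = 0.
    by apply: clutching_row_eq0 => //; rewrite ?e3 ?e4 mulrAC rpredM.
  by move: det1; rewrite c0 d0 !mulr0 subr0 => /eqP; rewrite eq_sym oner_eq0.
- have [||w Lw ea] := clutching_row_divisible La Lb; rewrite ?e1 ?e2 ?rpredM //.
  have [||w' Lw' ec] := clutching_row_divisible Lc Ld; rewrite ?e3 ?e4 ?rpredM //.
  exists (w * d - b * w'); first by rewrite rpredB ?rpredM.
  by rewrite -[RHS]det1 ea ec; ring.
Qed.

End Clutching.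

(** * The fixator of the local chamber *)

Section Iwahori.
Local Open Scope ring_scope.
Variables (k : fieldType) (R : realType).
Local Notation K := (Kpi k).

(** Near the origin every root takes values smaller than 1, so a negative integer
    omega_minus y makes alpha + omega_minus y negative on the chamber. *)
Lemma nonneg_on_C_infty_O_minus alpha (y : K) :
  nonneg_on_C_infty R alpha y -> y \in O_minus k.
Proof.
rewrite /nonneg_on_C_infty /C_infty => nn; rewrite inE leNgt; apply/negP => neg.
have [m em m1] : exists2 m : int, omega_minus y = m%:E & m <= -1.
  move: neg; rewrite /omega_minus; case: ifP => // _; rewrite lte_fin => neg.
  by eexists; first by []; lia.
move: nn; rewrite em /= => /nbhs_ballP[e /= e0 He].
(* The vectors (-s, -3s) with s > 0 lie in the chamber, where alpha0 and alpha1
   are -s and -2s; alpha is s c there. *)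
pose c : R := match alpha with PosRoot n => -2 - 3 * n%:~R
                             | NegRoot n => 2 - 3 * n%:~R end.
(* The first bound keeps the vector in the ball, the second one gives s c < 1. *)
pose s : R := Num.min (e / 4) (2 * (`|c| + 1))^-1.
have c0 := normr_ge0 c.
have s0 : 0 < s by rewrite lt_min divr_gt0 //= invr_gt0; lra.
have se : s <= e / 4 by rewrite ge_min lexx.
have sc : s * c < 1.
  have h : s <= (2 * (`|c| + 1))^-1 by rewrite ge_min lexx orbT.
  have : s * (2 * (`|c| + 1)) <= 1.
    by rewrite -ler_pdivlMr ?div1r //; lra.
  have := ler_norm c; nra.
have : ball ((0, 0) : R * R) e (- s, - (3 * s)).
  by split; rewrite /= -ball_normE /= sub0r opprK ger0_norm; lra.
have chamber : root_eval alpha0 (- s, - (3 * s)) < 0 /\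
    root_eval alpha1 (- s, - (3 * s)) < 0 by rewrite /root_eval /=; split; lra.
move=> /He/(_ chamber).
have ev : root_eval alpha (- s, - (3 * s)) = s * c.
  by clearbody s; rewrite /c /root_eval; case: (alpha) => n /=; ring.
rewrite ev lee_fin.
have : m%:~R <= (-1)%:~R :> R by rewrite ler_int.
lra.
Qed.

End Iwahori.

(** * Monomial matrices and the normalizer of the torus *)

Section Normalizer.
Local Open Scope ring_scope.

Lemma mx2_eta (A : Type) (M : 'M[A]_2) : M = mx2 (M 0 0) (M 0 1) (M 1 0) (M 1 1).
Proof.
apply/matrixP => i j; rewrite mxE.
by case: i => [[|[|//]] ?]; case: j => [[|[|//]] ?] //=; congr (M _ _); apply: val_inj.
Qed.

Lemma mx2_inj (A : Type) (a b c d a' b' c' d' : A) :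
  mx2 a b c d = mx2 a' b' c' d' -> [/\ a = a', b = b', c = c' & d = d'].
Proof.
move=> E; have entry i j := congr1 (fun M : 'M_2 => M i j) E.
by move: (entry 0 0) (entry 0 1) (entry 1 0) (entry 1 1); rewrite !mxE.
Qed.

(** A matrix that intertwines two diagonal matrices maps eigenlines to
    eigenlines, and here the eigenvalues p and p^-1 are distinct. *)
Lemma intertwined_monomial (L : fieldType) (a b c d p y : L) :
  p != p^-1 -> a * d - b * c = 1 ->
  mx2 a b c d *m mx2 p 0 0 p^-1 = mx2 y 0 0 y^-1 *m mx2 a b c d ->
  [/\ b = 0, c = 0, d = a^-1 & a * d = 1] \/
  [/\ a = 0, d = 0, c = - b^-1 & b * - c = 1].
Proof.
move=> pp det1; rewrite !mx2M !mulr0 !mul0r !addr0 !add0r.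
move=> E; have [ea eb ec ed] := mx2_inj E.
have [a0|a0] := eqVneq a 0.
  have b0 : b != 0.
    by apply: contra_eq_neq det1 => ->; rewrite a0 !mul0r subr0 eq_sym oner_neq0.
  have ey : y = p^-1 by apply: (mulIf b0); rewrite -eb mulrC.
  have d0 : d = 0.
    apply/eqP; move: ed; rewrite ey invrK mulrC => /eqP.
    by rewrite -subr_eq0 -mulrBl mulf_eq0 subr_eq0 eq_sym (negbTE pp).
  have bc : b * - c = 1 by rewrite -det1 a0 mul0r sub0r mulrN.
  right; split=> //; apply: (mulfI b0).
  by rewrite -[c]opprK mulrN bc mulrN mulfV.
have ey : y = p by apply: (mulIf a0); rewrite -ea mulrC.
have b0 : b = 0.
  apply/eqP; move: eb; rewrite ey mulrC => /eqP.
  by rewrite -subr_eq0 -mulrBl mulf_eq0 subr_eq0 eq_sym (negbTE pp).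
have c0 : c = 0.
  apply/eqP; move: ec; rewrite ey mulrC => /eqP.
  by rewrite -subr_eq0 -mulrBl mulf_eq0 subr_eq0 (negbTE pp).
have ad : a * d = 1 by rewrite -det1 b0 mul0r subr0.
by left; split=> //; apply: (mulfI a0); rewrite ad mulfV.
Qed.

Variable F : fieldType.
Local Notation FX := {fraction {poly F}}.

Lemma rescale_frC (z c : F) : z != 0 -> rescale z (frC c) = frC c.
Proof. by move=> z0; rewrite rescale_tofrac // comp_polyC. Qed.

Lemma rescale_monomial (z c : F) (n : int) : z != 0 ->
  rescale z (frC c * frX F ^ n) = frC (c * z ^ n) * frX F ^ n.
Proof.
move=> z0; rewrite -[LHS]/(rescale_rmorphism z0 _) rmorphM fmorphXz /=.
by rewrite rescale_frC // rescale_frX // expfzMl rmorphM fmorphXz /= mulrA.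
Qed.

Lemma map_mx2 (A B : Type) (f : A -> B) a b c d :
  map_mx f (mx2 a b c d) = mx2 (f a) (f b) (f c) (f d).
Proof. by apply/matrixP => i j; rewrite !mxE; case: ifP; case: ifP. Qed.

(** These are the matrices of determinant 1 that are diagonal or antidiagonal with
    entries in F^* X^Z. *)
Definition monomial_mx (M : 'M[FX]_2) :=
  exists c (n : int), c != 0 /\
    let e := frC c * frX F ^ n in M = mx2 e 0 0 e^-1 \/ M = mx2 0 e (- e^-1) 0.

Lemma monomial_mx_rescale z M : z != 0 ->
  monomial_mx M -> monomial_mx (map_mx (rescale z) M).
Proof.
move=> z0 [c [n [c0 E]]]; exists (c * z ^ n), n.
split; first by rewrite mulf_neq0 ?expfz_neq0.
rewrite -rescale_monomial //.
by case: E => ->; [left|right];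
  rewrite map_mx2 -[rescale z]/(GRing.RMorphism.sort (rescale_rmorphism z0))
          !(rmorph0, rmorphN, fmorphV).
Qed.

(** The two nonzero entries have product 1 or -1, so they are units of the
    Laurent polynomials. *)
Lemma laurent_monomial_mx (M : 'M[FX]_2) (p y : F) :
  M \is a mxOver (laurent (predT : {pred F})) -> p != p^-1 -> \det M = 1 ->
  M *m mx2 (frC p) 0 0 (frC p^-1) = mx2 (frC y) 0 0 (frC y^-1) *m M ->
  monomial_mx M.
Proof.
move=> /mxOverP LM pp; rewrite (mx2_eta M) det_mx2 !fmorphV => det1 E.
have Cpp : frC p != (frC p)^-1 by rewrite -fmorphV (inj_eq (fmorph_inj _)).
have L' : - M 1 0 \in laurent (predT : {pred F}) by rewrite rpredN.
have [[b0 Mc0 ed e1]|[a0 d0 ec e1]] := intertwined_monomial Cpp det1 E.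
  have [c [n [c0 e]]] := laurent_unit (LM _ _) (LM _ _) e1.
  by exists c, n; split=> //=; left; rewrite -e b0 Mc0 ed.
have [c [n [c0 e]]] := laurent_unit (LM _ _) L' e1.
by exists c, n; split=> //=; right; rewrite -e a0 d0 ec.
Qed.

Lemma torus_subproof (y : F) : y != 0 ->
  is_affSL2 (mx2 (frC y) 0 0 (frC y^-1), 1).
Proof.
move=> y0; apply/and3P; split; rewrite /= ?oner_eq0 //.
  by apply: mxOver_mx2; rewrite ?rpred0 ?laurentC.
by rewrite det_mx2 mulr0 subr0 -rmorphM mulfV ?rmorph1.
Qed.

(** Comparing second components, the conjugate of (diag(p, p^-1), 1) has second
    component 1, and no rescaling remains in n t = (n t n^-1) n. *)
Lemma conj_torus_monomial (n t : affSL2 F) (p y z : F) : p != p^-1 ->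
  affval t = (mx2 (frC p) 0 0 (frC p^-1), 1) ->
  affval (n * t * n^-1)%g = (mx2 (frC y) 0 0 (frC y^-1), z) ->
  monomial_mx (val n).1.
Proof.
move=> pp Et E; have /and3P[/= Ln /eqP detn n0] := valP n.
have : aff_mul_val (affval (n * t * n^-1)%g) (affval n) =
    aff_mul_val (affval n) (affval t) := congr1 val (mulgVK n (n * t)%g).
rewrite E Et /aff_mul_val /=.
move=> -[EM /eqP]; rewrite mulr1 -[X in _ == X]mul1r (inj_eq (mulIf n0)).
move=> /eqP z1; apply: (laurent_monomial_mx (y := y) Ln pp detn).
move: EM; rewrite z1 map_rescale_id => ->.
have r0 : rescale (affval n).2 0 = 0.
  by rewrite -[LHS]/(rescale_rmorphism n0 0) rmorph0.
by rewrite map_mx2 !rescale_frC // r0.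
Qed.

(** The powers of X and the sign in a monomial matrix are units over S, so they
    can be absorbed in the rows of the second factor. *)
Lemma monomial_mul (S : subringClosed F) (M N : 'M[FX]_2) :
  monomial_mx M -> N \is a mxOver (laurent_over S) -> exists c x y z t,
    [/\ c != 0,
        M *m N = mx2 (frC c * x) (frC c * y) ((frC c)^-1 * z) ((frC c)^-1 * t)
      & [/\ x \in laurent_over S, y \in laurent_over S,
            z \in laurent_over S & t \in laurent_over S]].
Proof.
move=> [c [n [c0 E]]] /mxOverP LN.
have LuN j a b : frX F ^ j * N a b \in laurent_over S.
  by apply: rpredM; [exact: laurent_frXz | exact: LN].
set e := frC c * _ in E; have eV : e^-1 = (frC c)^-1 * frX F ^ (- n).
  by rewrite invfM invr_expz.
exists c; case: E => ->; rewrite [in X in _ *m X](mx2_eta N) mx2M.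
  exists (frX F ^ n * N 0 0), (frX F ^ n * N 0 1).
  exists (frX F ^ (- n) * N 1 0), (frX F ^ (- n) * N 1 1).
  split=> //; last by split; exact: LuN.
  by rewrite !mul0r !addr0 !add0r eV !mulrA.
exists (frX F ^ n * N 1 0), (frX F ^ n * N 1 1).
exists (- (frX F ^ (- n) * N 0 0)), (- (frX F ^ (- n) * N 0 1)).
split=> //; last by split; rewrite ?rpredN; exact: LuN.
by rewrite !mul0r !addr0 !add0r eV !mulrN !mulNr !mulrA.
Qed.

End Normalizer.

Section AffineNormalizer.
Local Open Scope ring_scope.
Variable k : fieldType.
Local Notation pi := (varpi k).

Lemma varpi_neqV : pi != pi^-1.
Proof.
apply/negP => /eqP e; have : pi * pi = 1 by rewrite {2}e mulfV ?varpi_neq0.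
rewrite /varpi /frX -tofracM -tofrac1 => /eqP; rewrite tofrac_eq -expr2 => /eqP.
move/(congr1 (fun p : {poly k} => p`_0)); rewrite coefXn coef1 => /eqP.
by rewrite eq_sym oner_eq0.
Qed.

(** It suffices to conjugate the single element (diag(varpi, varpi^-1), 1). *)
Lemma N_aff_monomial n : N_aff k n -> monomial_mx (val n).1.
Proof.
move=> Nn; pose t := AffSL2 (torus_subproof (varpi_neq0 k)).
have : torus (n * t * n^-1)%g.
  rewrite -Nn; exists t => //; exists pi, 1.
  by split; [exact: varpi_neq0 | exact: oner_neq0 |].
move=> [y [z [_ _ E]]].
exact: (@conj_torus_monomial _ n t pi y z varpi_neqV erefl E).
Qed.

End AffineNormalizer.

(** * Failure of the Birkhoff decomposition *)

Section LaurentCoefficientRings.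
Local Open Scope ring_scope.
Variable k : fieldType.
Local Notation "x %:F" := (FracField.tofrac x) : ring_scope.
Local Notation K := (Kpi k).
Local Notation p := (frC (varpi k) : Kpiu k).

Lemma laurent_pole_plus_eq0 x :
  x \in laurent (O_pole k) -> x / p \in laurent (O_plus k) -> x = 0.
Proof.
move=> Lx Ly; have [n [f [g [Of Og xf yg]]]] := laurent_common Lx Ly.
have X0 : frX K ^+ n != 0 by rewrite expf_neq0 ?frX_neq0.
have p0 : p != 0 by rewrite frC_eq0 varpi_neq0.
have efg : f = varpi k *: g.
  apply/eqP; rewrite -mul_polyC -tofrac_eq tofracM; apply/eqP/(divIf X0).
  by rewrite -mulrA -yg -xf mulrCA mulfV ?mulr1.
rewrite xf (_ : f = 0) ?tofrac0 ?mul0r //; apply/polyP => i; rewrite coef0.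
apply: O_pole_O_plus_eq0; first exact: (polyOverP Of).
rewrite efg coefZ mulrAC mulfV ?varpi_neq0 // mul1r; exact: (polyOverP Og).
Qed.

Lemma laurent_pole_split x : x \in laurent (O_pole k) ->
  exists c b, [/\ c \in laurent (O_plus k), c \in laurent (O_pole k),
                  b \in laurent (O_pole k) & x = c + b / p].
Proof.
move=> /asboolP[n [f [/polyOverP Of ->]]].
have /choice[cb Hcb] (i : nat) : exists cb : K * K,
    [/\ cb.1 \in O_plus k, cb.1 \in O_pole k, cb.2 \in O_pole k
      & f`_i = cb.1 + cb.2 / varpi k].
  by have [c [b [? ? ? ?]]] := O_pole_split (Of i); exists (c, b).
exists ((\poly_(i < size f) (cb i).1)%:F / frX K ^+ n).
exists ((\poly_(i < size f) (cb i).2)%:F / frX K ^+ n).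
split; try (apply/asboolP; exists n; eexists; split; last by []).
- by apply: polyOver_poly => i _; have [] := Hcb i.
- by apply: polyOver_poly => i _; have [] := Hcb i.
- by apply: polyOver_poly => i _; have [] := Hcb i.
have key (L : fieldType) (a b s t r : L) : r = a + b / s -> r / t = a / t + b / t / s.
  by move=> ->; rewrite mulrDl mulrAC.
apply: key; rewrite -fmorphV -tofracM -tofracD; congr (_%:F).
apply/polyP => i; rewrite coefD coefMC !coef_poly.
case: ltnP => [_|fi]; first by have [_ _ _] := Hcb i.
by rewrite nth_default // mul0r addr0.
Qed.

End LaurentCoefficientRings.

Section Birkhoff.
Local Open Scope ring_scope.
Variables (k : fieldType) (R : realType).
Local Notation K := (Kpi k).
Local Notation p := (frC (varpi k) : Kpiu k).
Local Notation v := ((uvar k)^-1).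

Lemma O_minus_unit (y : K) : omega_minus y = 0%E ->
  [/\ y != 0, y \in O_minus k & y^-1 \in O_minus k].
Proof.
move=> y1; have y0 : y != 0.
  by apply/eqP => y0; move: y1; rewrite y0 /omega_minus eqxx.
split=> //; first by rewrite inE y1.
move: y1; have [f [g [f0 g0 ->]]] := Kpi_fracP y0.
rewrite invf_div inE !omega_minus_frac // => -[/eqP].
by rewrite lee_fin subr_eq0 => /eqP ->; rewrite subrr.
Qed.

Lemma I_infty_over : I_infty k R `<=` affSL2_over (O_pole k).
Proof.
move=> g [Cg /G_twin_over[/mxOverP twM twz twV]].
have : affSL2_over (O_minus k) g.
  move: Cg; apply: generated_affSL2_over => {twM twz twV} h.
  case=> [[y [z [/O_minus_unit[y0 Oy OVy] /O_minus_unit[z0 Oz OVz] e]]]|].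
    rewrite /affSL2_over /= e; split=> //.
    by apply: diagmx_over; apply: laurent_frC.
  move=> [alpha [y [/nonneg_on_C_infty_O_minus Oy ->]]].
  exact: root_elt_over.
move=> [/mxOverP mM mz mV]; split.
- by apply/mxOverP => i j; apply: laurentI.
- by apply/andP.
- by apply/andP.
Qed.

Lemma counterexampleE : (val (counterexample k)).1 = clutching p v.
Proof. by rewrite /= fmorphV. Qed.

Lemma O_plus_trichotomy_frC (c : K) : c != 0 ->
  [\/ frC c / p \in laurent_over (O_plus k),
      (frC c)^-1 / p \in laurent_over (O_plus k)
    | (frC c \in laurent_over (O_plus k)) &&
      ((frC c)^-1 \in laurent_over (O_plus k))].
Proof.
move=> c0; have [h|h|/andP[h h']] := O_plus_trichotomy c0.
- by apply: Or31; exact: laurent_frC_div h.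
- by apply: Or32; exact: laurent_frCV_div h.
- by apply: Or33; apply/andP; split; [exact: laurent_frC h | exact: laurent_frCV h'].
Qed.

(** In i n h the variable is rescaled in the matrices of n and h.  Rescaling keeps
    the matrix of n monomial; that of h is rescaled by the product of the first
    two second components, which is the inverse of the second component of h,
    a unit of O_plus. *)
Lemma counterexample_not_INK :
  ~ setmul (setmul (I_infty k R) (N_aff k)) (K_aff k) (counterexample k).
Proof.
move=> [_ [i /I_infty_over[iM iz iV] [n /N_aff_monomial Nn <-]]].
move=> [h /K_aff_over[hM hz hV]] E.
have /and3P[_ /eqP deti i0] := valP i; have /and3P[_ _ n0] := valP n.
have /and3P[_ _ h0] := valP h.
have [EM Ez] : (val (counterexample k)).1 =
    (val i).1 *m map_mx (rescale (val i).2) (val n).1 *m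
      map_mx (rescale ((val i).2 * (val n).2)) (val h).1 /\
    (val i).2 * (val n).2 * (val h).2 = 1.
  by split; [exact: (congr1 (fun g => (affval g).1) (esym E))
            |exact: (congr1 (fun g => (affval g).2) E)].
have inE2 : (val i).2 * (val n).2 = (val h).2^-1.
  by apply: (mulIf h0); rewrite Ez mulVf.
move: EM; rewrite inE2 counterexampleE.
set B := map_mx _ (val n).1; set C := map_mx _ (val h).1 => EM.
have Bm : monomial_mx B := monomial_mx_rescale i0 Nn.
have LC : C \is a mxOver (laurent_over (O_plus k)).
  have hV0 : (val h).2^-1 != 0 by rewrite invr_eq0.
  have hVV : (val h).2^-1^-1 \in O_plus k by rewrite invrK.
  exact: (mxOver_rescale_over hV0 hV hVV hM).
have [c [x [y [z [t [c0 EBC Lxyzt]]]]]] := monomial_mul Bm LC.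
set Q := \adj (val i).1.
have LQ : Q \is a mxOver (laurent_over (O_pole k)) by exact: mxOver_adj2 iM.
have EQ : Q *m clutching p v = B *m C.
  by rewrite EM !mulmxA mul_adj_mx deti mul1mx.
have detQ : \det Q = 1.
  have := congr1 determinant (mul_mx_adj (val i).1).
  by rewrite det_mulmx deti mul1r det1.
move: EQ detQ; rewrite EBC (mx2_eta Q) det_mx2 => EQ detQ.
have LQe a b : Q a b \in laurent_over (O_pole k) by exact: (mxOverP LQ).
have p0 : p != 0 by rewrite frC_eq0; exact: varpi_neq0.
have [w Lw] := clutching_not_split
  (Lminus := laurent_over (O_pole k)) (Lplus := laurent_over (O_plus k))
  p0 (laurent_1DVsq_neq0 K) (laurent_frXz _ (-1)) (laurent_frXz _ (-1))
  (laurent_frCV (O_pole_Vvarpi k))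
  (@laurent_pole_plus_eq0 k) (@laurent_pole_split k)
  (And4 (LQe _ _) (LQe _ _) (LQe _ _) (LQe _ _))
  detQ Lxyzt EQ (O_plus_trichotomy_frC c0).
have Lw' : w \in laurent (predT : {pred K}) by exact: laurent_sub Lw.
by move/eqP; apply/negP; exact: not_laurent_unit_1DVsq.
Qed.

End Birkhoff.

Theorem mainTheorem4 (k : fieldType) (R : realType) :
  [/\ G_twin k (counterexample k),
      ~ setmul (setmul (I_infty k R) (N_aff k)) (K_aff k) (counterexample k)
    & ~ (G_twin k `<=` setmul (setmul (I_infty k R) (N_aff k)) (K_aff k))].
Proof.
split; [exact: counterexample_twin | exact: counterexample_not_INK |].
move=> sub; apply: (@counterexample_not_INK k R); apply: sub.
exact: counterexample_twin.
Qed.
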